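(* For any integer $n\ge 2$, the polynomial $$\ell_I(\Gamma(D_n),x)=\sum_{i=1}^{\lfloor n/2\rfloor}\frac{n-2}{i}\binom{2i-2}{i-1}\binom{n-2}{2i-2}x^i(1+x)^{n-2i}$$ has only real zeros.
   Context: This polynomial is the local $h$-polynomial of the type $D_n$ cluster subdivision. A polynomial has only real zeros if all of its complex zeros are real (the zero polynomial being regarded as trivially satisfying this). *)

(* Defs.v *)
From HB Require Import structures.
From mathcomp Require Import all_boot all_order all_algebra.
From mathcomp Require Import complex reals.

Set Implicit Arguments.
Unset Strict Implicit.
Unset Printing Implicit Defensive.

Import Order.TTheory GRing.Theory Num.Theory.
Local Open Scope ring_scope.
Local Open Scope complex_scope.

Definition real_rooted (R : realType) (p : {poly R}) : Prop :=
  p = 0 \/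
  forall z : R[i], root (map_poly (real_complex R) p) z -> z \is Num.real.

(* The local h-polynomial of the type D_n cluster subdivision, given by its
   explicit gamma-expansion; the natural-number subtractions are exact when
   2 <= n, since then 1 <= i and 2 * i <= n throughout the sum. *)
Definition local_h_D (R : realType) (n : nat) : {poly R} :=
  \sum_(1 <= i < n./2.+1)
    ((n - 2)%:R / i%:R * 'C(2 * i - 2, i - 1)%:R * 'C(n - 2, 2 * i - 2)%:R)
      *: ('X^i * (1 + 'X) ^+ (n - 2 * i)).

(* Main.v *)
(* With N = n - 2 and f = X (X + 1), the Taylor expansion
   f(t + h) = f(t) + f'(t) h + h^2 gives the coefficient of h^N in
   f(t + h)^(N + 1), that is the N-th derivative of f^(N + 1) at t divided
   by N!, as a sum over j of terms f(t)^(j + 1) f'(t)^(N - 2 j).  For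
   x = (1 + t) / t one has x = f(t) / t^2 and 1 + x = f'(t) / t, so this sum is
   a multiple of the local h-polynomial at x.  The polynomial f^(N + 1) has
   only real zeros, hence so have its derivatives by Gauss-Lucas, and x <> 1 is
   real when t = 1 / (x - 1) is. *)
Require Import Defs.
From mathcomp Require Import all_boot all_order all_algebra.
From mathcomp Require Import complex reals.
From mathcomp Require Import ring zify.

Set Implicit Arguments.
Unset Strict Implicit.
Unset Printing Implicit Defensive.

Import Order.TTheory GRing.Theory Num.Theory.
Local Open Scope ring_scope.

(** Admitting the zero polynomial makes the property stable under differentiation, constants
    included. *)
Definition zero_or_real_roots (C : numClosedFieldType) (p : {poly C}) : Prop :=
  p = 0 \/ forall z, root p z -> z \is Num.real.

Lemma horner_deriv_prod_XsubC (F : fieldType) (s : seq F) (z : F) :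
  z \notin s ->
  (\prod_(a <- s) ('X - a%:P))^`().[z] =
  (\prod_(a <- s) ('X - a%:P)).[z] * \sum_(a <- s) (z - a)^-1.
Proof.
elim: s => [|a s IHs]; first by rewrite !big_nil derivC !hornerE.
rewrite inE negb_or => /andP[za /IHs{}IHs].
rewrite !big_cons derivM derivXsubC mul1r !hornerE IHs.
have za0 : z - a != 0 by rewrite subr_eq0.
by rewrite mulrDr mulrAC mulfV // mul1r mulrA.
Qed.

Lemma Im_inv_sub_real (C : numClosedFieldType) (z a : C) :
  a \is Num.real -> 'Im (z - a)^-1 = - 'Im z / `|z - a| ^+ 2.
Proof.
move=> /Creal_ImP a0.
rewrite -[(z - a)^-1]mul1r Im_div (Creal_ImP _ (rpred1 _)) mulr0 sub0r.
by rewrite (Creal_ReP _ (rpred1 _)) mul1r raddfB /= a0 subr0.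
Qed.

(* Away from the real axis, all the terms 1 / (z - a) of the logarithmic
   derivative have nonzero imaginary parts of the same sign. *)
Lemma zero_or_real_roots_deriv (C : numClosedFieldType) (p : {poly C}) :
  zero_or_real_roots p -> zero_or_real_roots p^`().
Proof.
case=> [->|preal]; first by left; rewrite deriv0.
have [p_small|p_large] := leqP (size p) 1.
  by left; rewrite (size1_polyC p_small) derivC.
right=> z; have [s pE] := closed_field_poly_normal p.
have lc0 : lead_coef p != 0.
  by rewrite lead_coef_eq0 -size_poly_gt0 ltnW.
have sreal : {in s, forall a, a \is Num.real}.
  by move=> a sa; apply: preal; rewrite pE rootZ // root_prod_XsubC.
have s_nonempty : (0 < size s)%N.
  by move: p_large; rewrite pE size_scale // size_prod_XsubC.
apply: contraTT => z_nreal.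
have zs : z \notin s by apply: contra z_nreal => /sreal.
rewrite pE derivZ rootZ // /root horner_deriv_prod_XsubC // mulf_neq0 //.
  by rewrite -/(root _ _) root_prod_XsubC.
have ImE : 'Im (\sum_(a <- s) (z - a)^-1) =
    - 'Im z * \sum_(a <- s) `|z - a| ^- 2.
  rewrite raddf_sum mulr_sumr; apply: eq_big_seq => a /sreal.
  exact: Im_inv_sub_real.
apply: contra_neq (_ : 'Im (\sum_(a <- s) (z - a)^-1) != 0) => [->|].
  by rewrite raddf0.
rewrite ImE mulf_neq0 // ?oppr_eq0.
  by apply: contra z_nreal => /eqP/Creal_ImP.
case: s s_nonempty zs {pE sreal ImE} => // a s _.
rewrite inE negb_or => /andP[za _]; rewrite big_cons gt_eqF //.
apply: ltr_wpDr; first by apply: sumr_ge0 => b _; rewrite invr_ge0 exprn_ge0.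
by rewrite invr_gt0 exprn_gt0 // normr_gt0 subr_eq0.
Qed.

Lemma zero_or_real_roots_nderivn (C : numClosedFieldType) (p : {poly C}) k :
  zero_or_real_roots p -> zero_or_real_roots p^`N(k).
Proof.
move=> preal; have : zero_or_real_roots p^`(k).
  elim: k => [|k IHk]; first by rewrite derivn0.
  by rewrite derivnS; apply: zero_or_real_roots_deriv.
have k0 : k`!%:R != 0 :> C by rewrite pnatr_eq0 -lt0n fact_gt0.
rewrite nderivn_def -scaler_nat => -[/eqP|H].
  by rewrite scaler_eq0 (negPf k0) => /eqP; left.
by right=> z pz; apply: H; rewrite rootZ.
Qed.

Lemma horner_nderivn (R : comNzRingType) (p : {poly R}) k (c : R) :
  p^`N(k).[c] = (p \Po ('X + c%:P))`_k.
Proof.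
rewrite /comp_poly addrC.
(* Taylor's formula over [{poly R}] at the point [c%:P] with increment ['X]. The bound [maxn] keeps
   the index [k] in the sum even beyond the degree of [p]. *)
rewrite (@nderiv_taylor_wide _ (maxn (size p) k.+1)); last 2 first.
- exact: mulrC.
- by rewrite (size_map_inj_poly (@polyC_inj _)) // leq_maxl.
have kb : (k < maxn (size p) k.+1)%N by rewrite leq_maxr.
rewrite coef_sum (bigD1 (Ordinal kb)) //= big1 ?addr0 => [|i ik].
  by rewrite nderivn_map horner_map /= coefCM coefXn eqxx mulr1.
rewrite nderivn_map horner_map /= coefCM coefXn.
by rewrite eq_sym -val_eqE /= in ik *; rewrite (negPf ik) mulr0.
Qed.

(** In the binomial expansion, the term without [u] is divisible by ['X^(N.+1)]. The term in
    [u ^+ j.+1] carries ['X^(N - j) * ('X + v%:P) ^+ (N - j)], from whose second factor the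
    coefficient of ['X^j] is needed. *)
Lemma coef_exp_quadratic (R : comNzRingType) (u v : R) N :
  (('X * ('X + v%:P) + u%:P) ^+ N.+1)`_N =
  \sum_(j < N.+1) u ^+ j.+1 * v ^+ (N - 2 * j) *
     ('C(N.+1, j.+1) * 'C(N - j, j))%:R.
Proof.
rewrite exprDn coef_sum big_ord_recl subn0 expr0 mulr1 exprMn coefMn.
rewrite coefXnM ltnSn mul0rn add0r; apply: eq_bigr => j _.
rewrite lift0 subSS coefMn -polyC_exp coefMC exprMn coefXnM.
have jN : (j <= N)%N by rewrite -ltnS.
rewrite ltnNge leq_subr /= subKn // addrC exprDn coef_sum.
have coef_term (i : 'I_(N - j).+1) :
    (((v%:P) ^+ (N - j - i) * 'X^i) *+ 'C(N - j, i))`_j =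
    if i == j :> nat then v ^+ (N - 2 * j) *+ 'C(N - j, j) else 0.
  rewrite coefMn -polyC_exp coefCM coefXn eq_sym.
  case: eqP => [->|_]; last by rewrite mulr0 mul0rn.
  by rewrite mulr1; congr (v ^+ _ *+ _); lia.
rewrite (eq_bigr _ (fun i _ => coef_term i)) natrM.
(* If [N < 2 * j], then ['C(N - j, j)] vanishes, so the truncated exponent [N - 2 * j] is
   harmless. *)
have [jNj|Njj] := ltnP (N - j) j.
  rewrite big1 ?(bin_small jNj) => [|i _].
    by rewrite !mulr0 mul0r mul0rn.
  by rewrite ifN_eq //; have := ltn_ord i; lia.
rewrite (bigD1 (Ordinal (Njj : (j < (N - j).+1)%N))) //= eqxx big1 => [|i].
  by rewrite addr0 mulrA !mulr_natr mulrnAl mulrnAC [_ * u ^+ _]mulrC.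
by rewrite -val_eqE /= => /negPf->.
Qed.

(** Both sides equal the trinomial coefficient [N! / (j! j! (N - 2 j)!)]. *)
Lemma bin_double_bin N j : (2 * j <= N)%N ->
  ('C(2 * j, j) * 'C(N, 2 * j) = 'C(N, j) * 'C(N - j, j))%N.
Proof.
move=> jN; set a := j`!; set b := (N - 2 * j)`!.
have f0 (m : nat) : (0 < m`!)%N := fact_gt0 m.
apply/eqP; rewrite -(eqn_pmul2r (m := a * a * b)) ?muln_gt0 ?f0 //; apply/eqP.
have E1 : ('C(2 * j, j) * (a * a))%N = (2 * j)`!.
  by rewrite -(@bin_fact (2 * j) j) /a; [congr (_ * (_ * _`!))%N; lia | lia].
have E2 : ('C(N, 2 * j) * ((2 * j)`! * b))%N = N`! by apply: bin_fact.
have E3 : ('C(N, j) * (a * (N - j)`!))%N = N`! by apply: bin_fact; lia.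
have E4 : ('C(N - j, j) * (a * b))%N = (N - j)`!.
  by rewrite -(@bin_fact (N - j) j) /a /b; [congr (_ * (_ * _`!))%N; lia | lia].
transitivity N`!.
  by rewrite -E2 -E1; ring.
by rewrite -E3 -E4; ring.
Qed.

(** Links the Taylor coefficients to the Catalan numbers ['C(2 * j, j) / j.+1] of the
    gamma-expansion. *)
Lemma bin_catalan N j : (2 * j <= N)%N ->
  ('C(N.+1, j.+1) * 'C(N - j, j) * j.+1 =
   N.+1 * ('C(2 * j, j) * 'C(N, 2 * j)))%N.
Proof.
move=> jN; rewrite bin_double_bin // mulnA mul_bin_diag; lia.
Qed.

Lemma horner_nderivn_quadratic_exp (R : comNzRingType) (t : R) N :
  (('X * ('X + 1)) ^+ N.+1)^`N(N).[t] =
  \sum_(j < N.+1) (t * (t + 1)) ^+ j.+1 * (2%:R * t + 1) ^+ (N - 2 * j) *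
     ('C(N.+1, j.+1) * 'C(N - j, j))%:R.
Proof.
rewrite horner_nderivn -coef_exp_quadratic rmorphXn /=.
suff -> : 'X * ('X + 1) \Po ('X + t%:P) =
    'X * ('X + (2%:R * t + 1)%:P) + (t * (t + 1))%:P by [].
rewrite comp_polyM comp_polyD comp_polyX -[1 in LHS]polyC1 comp_polyC.
rewrite !(polyCD, polyCM) polyC1; ring.
Qed.

Lemma real_root_nderivn_quadratic_exp (C : numClosedFieldType) (t : C) N :
  root (('X * ('X + 1)) ^+ N.+1)^`N(N) t -> t \is Num.real.
Proof.
set f := 'X * _.
have fmonic : f \is monic by rewrite monicMl ?monicX // -polyC1 monicXaddC.
have fsize : size (f ^+ N.+1) = (2 * N.+1).+1%N.
  have sf : size f = 3.
    rewrite size_monicM ?monicX -?polyC1 ?size_XaddC ?size_polyX //.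
    by rewrite monic_neq0 // monicXaddC.
  rewrite -(prednK (_ : 0 < size (f ^+ N.+1))%N) ?size_exp ?sf //.
  by rewrite size_poly_gt0 monic_neq0 // monic_exp.
have : zero_or_real_roots (f ^+ N.+1)^`N(N).
  apply: zero_or_real_roots_nderivn; right=> z.
  rewrite /root horner_exp expf_eq0 /= !hornerE mulf_eq0 => /orP[/eqP->//|].
  by rewrite addr_eq0 => /eqP->; rewrite rpredN rpred1.
case=> [/(congr1 (fun p : {poly C} => p`_N.+2)) /eqP|]; last by apply.
rewrite coef_nderivn coef0 -mulr_natr mulf_eq0 pnatr_eq0.
have -> : (N + N.+2)%N = (size (f ^+ N.+1)).-1 by lia.
rewrite -lead_coefE (monicP (monic_exp _ fmonic)) oner_eq0 /=.
by rewrite -leqn0 leqNgt bin_gt0 fsize; lia.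
Qed.

Lemma real_root_gamma_sum (C : numClosedFieldType) N (x : C) :
  \sum_(j < N./2.+1) (x ^+ j * (1 + x) ^+ (N - 2 * j)) *
    ('C(N.+1, j.+1) * 'C(N - j, j))%:R = 0 ->
  x \is Num.real.
Proof.
move=> sum0; have [->//|x1] := eqVneq x 1.
have d0 : x - 1 != 0 by rewrite subr_eq0.
pose t := (x - 1)^-1.
have tE : t * (x - 1) = 1 by rewrite mulVf.
suff : t \is Num.real.
  by rewrite /t realV => /(rpredD (rpred1 _)); rewrite addrC subrK.
apply: (@real_root_nderivn_quadratic_exp C t N).
have uE : t * (t + 1) = t ^+ 2 * x.
  by transitivity (t * (t + t * (x - 1))); [rewrite tE | ring].
have vE : 2%:R * t + 1 = t * (1 + x).
  by transitivity (2%:R * t + t * (x - 1)); [rewrite tE | ring].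
rewrite /root horner_nderivn_quadratic_exp uE vE.
have hN : (N./2.+1 <= N.+1)%N by lia.
(* The sum is extended to all [j <= N]; the added terms match terms of the derivative that vanish
   with ['C(N - j, j)]. *)
rewrite (big_ord_widen_cond N.+1 xpredT
    (fun j => (x ^+ j * (1 + x) ^+ (N - 2 * j)) *
    ('C(N.+1, j.+1) * 'C(N - j, j))%:R)) // in sum0.
(* Each term has the same power of [t], since [2 * j.+1 + (N - 2 * j) = N.+2]. *)
apply/eqP; transitivity (t ^+ N.+2 * x * 0); last by rewrite mulr0.
rewrite -[in RHS]sum0 mulr_sumr [RHS]big_mkcond /=; apply: eq_bigr => j _.
case: ltnP => jN; last by rewrite (@bin_small (N - j)) ?muln0 ?mulr0 //; lia.
have -> : t ^+ N.+2 = (t ^+ 2) ^+ j.+1 * t ^+ (N - 2 * j).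
  by rewrite -exprM -exprD; congr (_ ^+ _); lia.
by rewrite !exprMn [x ^+ j.+1]exprS; ring.
Qed.

Theorem theorem3p4 (R : realType) (n : nat) (hn : (2 <= n)%N) :
  real_rooted (local_h_D R n).
Proof.
case: n hn => [//|[//|N _]].
(* Here [n] is [N.+2]; for [N = 0] the factor [n - 2] makes the polynomial zero. *)
have [->|N0] := posnP N.
  left; rewrite /local_h_D big1_seq // => i _.
  by rewrite !mul0r scale0r.
right=> z; have [->//|z0] := eqVneq z 0.
rewrite /root /local_h_D => /eqP pz0.
apply: (@real_root_gamma_sum _ N z).
have cN : N%:R != 0 :> R[i]%C by rewrite pnatr_eq0 -lt0n.
(* After the shift [i = j.+1], [N * z] times the gamma sum equals [N.+1] times the local
   h-polynomial at [z], compared term by term. *)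
apply: (mulfI (mulf_neq0 cN z0)); rewrite mulr0.
rewrite -[RHS](mulr0 N.+1%:R) -[in RHS]pz0.
rewrite raddf_sum horner_sum big_add1 /= big_mkord !mulr_sumr.
apply: eq_bigr => j _.
have jN : (2 * j <= N)%N by have := ltn_ord j; lia.
have -> : (N.+2 - 2 * j.+1 = N - 2 * j)%N by lia.
have -> : (2 * j.+1 - 2 = 2 * j)%N by lia.
rewrite !subSS !subn0 map_polyZ hornerZ.
have -> :
    (map_poly (real_complex R) ('X^(j.+1) * (1 + 'X) ^+ (N - 2 * j))).[z] =
    z ^+ j.+1 * (1 + z) ^+ (N - 2 * j).
  rewrite rmorphM hornerM /= map_polyXn hornerXn.
  rewrite rmorphXn horner_exp rmorphD rmorph1 /= map_polyX.
  by rewrite hornerD hornerX hornerC.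
rewrite !(rmorphM (real_complex R)) fmorphV !(rmorph_nat (real_complex R)).
have j0 : j.+1%:R != 0 :> R[i]%C by rewrite pnatr_eq0.
have := bin_catalan jN; move/(congr1 (fun m => m%:R : R[i]%C)).
rewrite !natrM.
move: 'C(_, _)%:R 'C(_, _)%:R 'C(_, _)%:R 'C(_, _)%:R => d c b a binE.
have -> : a * b = N.+1%:R * (c * d) / j.+1%:R by rewrite -binE mulfK.
rewrite exprS.
by move: (_ ^+ _) (_ ^+ _) (N.+1%:R) (N%:R) (j.+1%:R^-1) => *; ring.
Qed.
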